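(* Let $\mathcal{H}$ be a real Hilbert space, let $m$ be a positive integer, let $T:\mathcal{H}\to\mathcal{H}$ be a continuous linear self-adjoint operator, and let $c,c_1,\dots,c_m\in\mathcal{H}$, $\alpha_1,\dots,\alpha_m\in\mathbb{R}$. Put $f(x)=\frac12\langle x,Tx\rangle+\langle c,x\rangle$ and $F=\{x\in\mathcal{H}\mid \langle c_i,x\rangle+\alpha_i\leqslant 0,\ i=1,\dots,m\}$. Suppose that $\langle x,Tx\rangle$ is a Legendre form, that $F$ is nonempty, and that $f$ is bounded from below over $F$. Then the quadratic programming problem under linear constraints of minimizing $f(x)$ subject to $x\in F$ has a solution, i.e. there is $\bar x\in F$ with $f(\bar x)\leqslant f(x)$ for all $x\in F$.
   Context: A continuous quadratic form $Q(x)=\langle x,Tx\rangle$ on $\mathcal{H}$ is a Legendre form if (a) $Q$ is weakly lower semicontinuous, and (b) $x_k\to x_0$ strongly whenever $x_k\rightharpoonup x_0$ (weak convergence) and $Q(x_k)\to Q(x_0)$. *)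

(* Defs.v *)
From mathcomp Require Import all_boot all_order all_algebra.
From mathcomp Require Import all_classical all_reals all_analysis.

Set Implicit Arguments.
Unset Strict Implicit.
Unset Printing Implicit Defensive.

Import Order.TTheory GRing.Theory Num.Theory.
Import numFieldNormedType.Exports.

Local Open Scope classical_set_scope.
Local Open Scope ring_scope.

Section Defs.
Context (R : realType) (H : completeNormedModType R).

(* A real Hilbert space is a complete normed module [H] together with an inner
   product [dot : {dot H for idfun}] that induces the norm of [H]. *)
Definition hilbert_dot (dot : {dot H for idfun}) : Prop :=
  forall x : H, `|x| = Num.sqrt (dot x x).

Variable dot : {dot H for idfun}.

Definition self_adjoint (T : H -> H) : Prop :=
  forall x y : H, dot (T x) y = dot x (T y).

Definition weak_cvg (u : nat -> H) (l : H) : Prop :=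
  forall y : H, dot y (u k) @[k --> \oo] --> dot y l.

(* Lower semicontinuity along weakly convergent sequences; lower semicontinuity
   for the weak topology implies it. *)
Definition weakly_lsc (Q : H -> R) : Prop :=
  forall (u : nat -> H) (l : H), weak_cvg u l ->
    ((Q l)%:E <= limn_einf (fun k => (Q (u k))%:E))%E.

Definition quad_form (T : H -> H) (x : H) : R := dot x (T x).

Definition legendre_form (Q : H -> R) : Prop :=
  weakly_lsc Q /\
  forall (u : nat -> H) (l : H),
    weak_cvg u l -> Q (u k) @[k --> \oo] --> Q l -> u k @[k --> \oo] --> l.

Definition qp_objective (T : H -> H) (c x : H) : R :=
  2^-1 * dot x (T x) + dot c x.

Definition qp_feasible (m : nat) (ci : 'I_m -> H) (alpha : 'I_m -> R) : set H :=
  [set x | forall i : 'I_m, dot (ci i) x + alpha i <= 0].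

End Defs.

(* Main.v *)
Require Import Defs.
From mathcomp Require Import all_boot all_order all_algebra.
From mathcomp Require Import all_classical all_reals all_analysis.
From mathcomp Require Import ring lra.
Import Order.TTheory GRing.Theory Num.Theory.
Import numFieldNormedType.Exports.
Local Open Scope classical_set_scope.
Local Open Scope ring_scope.

(** Write [Q x = <x, T x>].  The Legendre property gives a compactness
    principle for [Q] that stands in for weak compactness and for the spectral
    theory of [T]: a bounded family [u] whose differences satisfy
    [Q (u i - u j) <= e] for every [e > 0], eventually along an ultrafilter,
    converges in norm ([legendre_ultra_cvg]).  Otherwise one could pick
    differences [d k] with norm bounded away from [0], almost orthogonal to the
    previous ones, and with [Q (d k) <= 1 / (k + 1)]; almost orthogonality
    makes them weakly null ([weak_cvg0_of_self]), and a weakly null sequence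
    on which [Q] is asymptotically nonpositive tends to [0] in norm
    ([legendre_cvg0]).  The bound on [Q (u i - u j)] is obtained each time from
    the midpoint identity
    [Q (y - x) = 4 (f x + f y - 2 f ((x + y) / 2))] ([objective_midpoint]),
    because [f] is bounded below at feasible midpoints.

    Fix [x0] in [F], and let [x k] in [F] minimize the Tikhonov regularization
    [f y + |y - x0|^2 / (k + 1)] over [F] up to an error [1 / (k + 1)].  Then
    [f (x k)] tends to the infimum of [f].  Follow [x k] along an ultrafilter
    finer than [\oo].

    If it stays bounded, it is a bounded minimizing family, and the compactness
    principle makes it converge to a minimizer ([bounded_minimizing]).

    If not, its norm tends to infinity.  The directions
    [u k = (x k - x0) / |x k - x0|] then converge to a unit vector [v] with
    [Q v <= 0] which is a recession direction of the polyhedron [F]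
    ([unbounded_direction]); boundedness below of [f] along the half-lines
    directed by [v] forces [<T y + c, v> >= 0] on [F]
    ([gradient_recession_ge0]).  Since [F] has finitely many constraints, all
    linear, [x k - v] is still feasible for large [k]: a constraint with
    [<c_i, v> = 0] is unaffected, and one with [<c_i, v> < 0] has a slack at
    [x k] that tends to infinity.  Now [f (x k - v) <= f (x k)], while
    [|x k - v - x0|^2] is smaller than [|x k - x0|^2] by at least [1]: the
    regularized value at [x k - v] is smaller by at least [1 / (k + 1)], against
    the choice of [x k] with an error strictly below [1 / (k + 1)]. *)

(** * Inner products *)

Section InnerProduct.
Context {R : realType} {H : completeNormedModType R}.
Context {dot : {dot H for idfun}}.
Hypothesis H_hilbert : hilbert_dot dot.

Lemma dotC x y : dot x y = dot y x.
Proof. by have := hermC dot x y; rewrite expr0 mul1r. Qed.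

Lemma dotDr x y z : dot x (y + z) = dot x y + dot x z.
Proof. exact: linearDr. Qed.

Lemma dotBr x y z : dot x (y - z) = dot x y - dot x z.
Proof. exact: linearBr. Qed.

Lemma dotZr a x y : dot x (a *: y) = a * dot x y.
Proof. exact: linearZr_LR. Qed.

Lemma dot0r x : dot x 0 = 0.
Proof. exact: linear0r. Qed.

Lemma dotDl x y z : dot (x + y) z = dot x z + dot y z.
Proof. by rewrite !(dotC _ z) dotDr. Qed.

Lemma dotBl x y z : dot (x - y) z = dot x z - dot y z.
Proof. by rewrite !(dotC _ z) dotBr. Qed.

Lemma dotZl a x y : dot (a *: x) y = a * dot x y.
Proof. by rewrite !(dotC _ y) dotZr. Qed.

Lemma dot0l x : dot 0 x = 0.
Proof. by rewrite dotC dot0r. Qed.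

Lemma dotxx x : dot x x = `|x| ^+ 2.
Proof.
rewrite H_hilbert sqr_sqrtr//.
have [->|x0] := eqVneq x 0; first by rewrite dot0r.
exact/ltW/neq0_dnorm_gt0.
Qed.

Lemma normDsq x y : `|x + y| ^+ 2 = `|x| ^+ 2 + 2 * dot x y + `|y| ^+ 2.
Proof. by rewrite -!dotxx dotDr !dotDl (dotC y x); ring. Qed.

Lemma normBsq x y : `|x - y| ^+ 2 = `|x| ^+ 2 - 2 * dot x y + `|y| ^+ 2.
Proof. by rewrite -!dotxx !dotBr !dotBl (dotC y x); ring. Qed.

Lemma cauchy_schwarz x y : `|dot x y| <= `|x| * `|y|.
Proof.
have [->|x0] := eqVneq x 0; first by rewrite dot0l !normr0 mul0r.
have [->|y0] := eqVneq y 0; first by rewrite dot0r !normr0 mulr0.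
have nx : 0 < `|x| by rewrite normr_gt0.
have ny : 0 < `|y| by rewrite normr_gt0.
have xy : 0 < `|x| * `|y| by rewrite mulr_gt0.
have := sqr_ge0 (`| `|y| *: x + `|x| *: y|).
have := sqr_ge0 (`| `|y| *: x - `|x| *: y|).
rewrite normBsq normDsq !normrZ !normr_id !(dotZl, dotZr).
move=> h1 h2; rewrite ler_norml; apply/andP; split.
- by rewrite -(ler_pM2l xy); nra.
- by rewrite -(ler_pM2l xy); nra.
Qed.

Lemma dot_cvg (I : Type) (F : set_system I) (FF : Filter F) (f g : I -> H) a b :
  f i @[i --> F] --> a -> g i @[i --> F] --> b ->
  dot (f i) (g i) @[i --> F] --> dot a b.
Proof.
move=> fa gb.
(* By polarization, only the continuity of the norm is needed. *)
have polar x y : dot x y = 2^-1 * (`|x + y| ^+ 2 - `|x| ^+ 2 - `|y| ^+ 2).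
  by rewrite normDsq; field.
rewrite polar; under eq_fun do rewrite polar.
apply: cvgMr; apply: cvgB; [apply: cvgB|]; rewrite !expr2.
- by apply: cvgM; apply: cvg_norm; apply: cvgD.
- by apply: cvgM; apply: cvg_norm.
- by apply: cvgM; apply: cvg_norm.
Qed.

(** If [y] kept a correlation at least [e] with infinitely many of the [d k],
    sums of [N] well-chosen, suitably signed, terms would correlate with [y]
    at least [N * e]; but each new term can be chosen almost orthogonal to the
    previous sum, so that such a sum has norm of order [sqrt N] only. *)
Lemma weak_cvg0_of_self (d : nat -> H) (C : R) :
  (forall k, `|d k| <= C) ->
  (forall j, dot (d j) (d k) @[k --> \oo] --> 0) ->
  weak_cvg dot d 0.
Proof.
move=> dC dd y; rewrite dot0r; apply/cvgr0Pnorm_lt => e e0.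
have [//|nlt] := pselect (\forall k \near \oo, `|dot y (d k)| < e).
have often (A : set nat) : (\forall k \near \oo, A k) ->
    exists2 k, A k & e <= `|dot y (d k)|.
  move=> nA; apply: contrapT => no; apply: nlt.
  near=> k; rewrite ltNge; apply/negP => ek; apply: no.
  by exists k => //; near: k.
have sums (N : nat) : exists S : H,
    [/\ N%:R * e <= dot y S, `|S| ^+ 2 <= N%:R * (2 + C ^+ 2) &
        dot S (d k) @[k --> \oo] --> 0].
  elim: N => [|N [S [yS nS Sd]]].
    exists 0; split; rewrite ?mul0r ?dot0r ?normr0 ?expr0n//.
    by under eq_fun do rewrite dot0l; exact: cvg_cst.
  have [k /= Sk yk] : exists2 k, `|dot S (d k)| < 1 & e <= `|dot y (d k)|.
    by apply: often; move/cvgr0Pnorm_lt : Sd; apply.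
  have dk2 : `|d k| ^+ 2 <= C ^+ 2.
    by rewrite lerXn2r ?nnegrE// (le_trans _ (dC k)).
  move: Sk; rewrite ltr_norml => /andP[Sk1 Sk2].
  have [s0|s0] := leP 0 (dot y (d k)).
  - exists (S + d k); split.
    + by rewrite dotDr (ger0_norm s0) in yk *; rewrite -natr1; nra.
    + by rewrite normDsq -natr1; nra.
    + under eq_fun do rewrite dotDl.
      by rewrite -[0]addr0; apply: cvgD.
  - exists (S - d k); split.
    + by rewrite dotBr (ltr0_norm s0) in yk *; rewrite -natr1; nra.
    + by rewrite normBsq -natr1; nra.
    + under eq_fun do rewrite dotBl.
      by rewrite -[0]subr0; apply: cvgB.
(* [N * e <= |y| * |S|] and [|S|^2 <= N * (2 + C^2)] bound [N] by [B]. *)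
pose B := `|y| ^+ 2 * (2 + C ^+ 2) / e ^+ 2.
pose N := (Num.truncn B).+1.
have BN : B < N%:R by rewrite truncnS_gt.
have N0 : 0 < N%:R :> R by rewrite ltr0n.
have [S [yS nS _]] := sums N.
have h : (N%:R * e) ^+ 2 <= (`|y| * `|S|) ^+ 2.
  rewrite lerXn2r ?nnegrE ?mulr_ge0 ?ler0n ?(ltW e0)//.
  by rewrite (le_trans yS)// (le_trans (ler_norm _))// cauchy_schwarz.
have : N%:R * e ^+ 2 <= `|y| ^+ 2 * (2 + C ^+ 2).
  rewrite -(ler_pM2l N0); rewrite !exprMn in h.
  have := ler_wpM2l (sqr_ge0 `|y|) nS; nra.
rewrite -ler_pdivlMr ?exprn_gt0// => /(lt_le_trans BN).
by rewrite ltxx.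
Unshelve. all: by end_near. Qed.

(** * Ultrafilters and Legendre forms *)

Lemma ultra_bounded_cvg (I : Type) (U : set_system I) (f : I -> R) (M : R) :
  UltraFilter U -> (\forall i \near U, `|f i| <= M) -> cvg (f @ U).
Proof.
move=> UU fM.
have fU : (f @ U) [set` `[- M, M]].
  by apply: filterS fM => i fi; rewrite /= in_itv/= -ler_norml.
have [p [_ clp]] := segment_compact _ fU.
apply/cvg_ex; exists p => A pA.
have [//|UnA] := in_ultra_setVsetC (f @^-1` A) UU.
by have [x [nAx Ax]] := clp _ _ (UnA : (f @ U) (~` A)) pA.
Qed.

Section Legendre.
Context {T : {linear H -> H}}.
Hypothesis T_legendre : legendre_form dot (quad_form dot T).
Local Notation Q := (quad_form dot T).

Lemma quadZ a x : Q (a *: x) = a ^+ 2 * Q x.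
Proof. by rewrite /quad_form linearZ/= dotZl dotZr mulrA -expr2. Qed.

Lemma quad0 : Q 0 = 0. Proof. exact: dot0l. Qed.

(** Weak lower semicontinuity at [0] supplies the missing bound
    [0 <= liminf Q (d k)], so that [Q (d k)] tends to [Q 0] and the second half
    of the Legendre property applies. *)
Lemma legendre_cvg0 (d : nat -> H) : weak_cvg dot d 0 ->
  (forall k, Q (d k) <= k.+1%:R^-1) -> d k @[k --> \oo] --> 0.
Proof.
move=> d0 Qd; apply: T_legendre.2 => //; rewrite quad0.
apply/cvgr0Pnorm_lt => e e0.
have := T_legendre.1 _ _ d0; rewrite quad0 limn_einf_lim.
rewrite (cvg_lim _ (@cvg_einfs_sup _ _))// => sup0.
have [_ [n _ <-] einf_n] : exists2 y,
    range (einfs (fun k => (Q (d k))%:E)) y & ((- e)%:E < y)%E.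
  by apply: ereal_sup_gt; apply: lt_le_trans sup0; rewrite lte_fin oppr_lt0.
near=> k; rewrite ltr_norml; apply/andP; split.
- rewrite -lte_fin (lt_le_trans einf_n)//; apply: ereal_inf_lbound.
  by exists k => //=; near: k; exact: nbhs_infty_ge.
- rewrite (le_lt_trans (Qd k))//; near: k.
  exact: (near_infty_natSinv_lt (PosNum e0)).
Unshelve. all: by end_near. Qed.

(** A compactness principle.  Every scalar family [<z, u i>] converges along
    [U], so differences [u i - u j] with [i, j] in a suitable member of [U] are
    almost orthogonal to any finite list of vectors; if [u] were not Cauchy
    along [U], they could moreover be chosen with norm at least [e].  Choosing
    each one almost orthogonal to all the previous ones yields a weakly null
    sequence that contradicts [legendre_cvg0]. *)
Lemma legendre_ultra_cvg (I : Type) (U : set_system I) (u : I -> H) (C : R) :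
  UltraFilter U -> (\forall i \near U, `|u i| <= C) ->
  (forall e : R, 0 < e -> exists2 A : set I, U A &
    forall i j, A i -> A j -> Q (u i - u j) <= e) ->
  cvg (u @ U).
Proof.
move=> UU uC uQ; apply: cauchy_cvg; apply: cauchy_exP => e e0.
apply: contrapT => nball.
have wcvg z : cvg (dot z (u i) @[i --> U]).
  apply: (@ultra_bounded_cvg _ _ _ (`|z| * C)) => //.
  apply: filterS uC => i uiC.
  by rewrite (le_trans (cauchy_schwarz _ _))// ler_wpM2l.
have step (l : seq H) : exists d : H, [/\ `|d| <= C + C, e <= `|d|,
    Q d <= (size l).+1%:R^-1 &
    forall z, z \in l -> `|dot z d| <= (size l).+1%:R^-1].
  pose close (q : R) i z := `|lim (dot z (u j) @[j --> U]) - dot z (u i)| <= q.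
  have Ul (q : R) : 0 < q ->
      \forall i \near U, forall z, z \in l -> close q i z.
    move=> q0; elim: l => [|z l IHl]; first exact: nearW.
    near=> i => z'; rewrite in_cons => /predU1P[->|z'l].
    - rewrite /close; near: i.
      exact: (cvgr_dist_le _ _ (wcvg z)).
    - by move: z' z'l; near: i.
  set q : R := _^-1; have q0 : 0 < q by rewrite invr_gt0.
  have [A UA QA] := uQ _ q0.
  have {}Ul := Ul _ (divr_gt0 q0 (ltr0Sn R 1)).
  have [i [Ai ui li]] : exists i, [/\ A i, `|u i| <= C & forall z, z \in l ->
      close (q / 2) i z].
    by apply: (@filter_ex _ U); near=> i; split; near: i.
  have [j [Aj uj lj ij]] : exists j, [/\ A j, `|u j| <= C, forall z, z \in l ->
      close (q / 2) j z &
      e <= `|u i - u j|].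
    (* Otherwise the ball of radius [e] around [u i] would be a member of the
       image of [U]. *)
    apply: contrapT => noj; apply: nball; exists (u i).
    suff : \forall j \near U, ball (u i) e (u j) by [].
    near=> j; rewrite -ball_normE/= ltNge; apply/negP => ij.
    by apply: noj; exists j; split=> //; near: j.
  exists (u i - u j); split=> //.
  - by rewrite (le_trans (ler_normB _ _))// lerD.
  - exact: QA.
  - move=> z zl; rewrite dotBr; have := li z zl; have := lj z zl.
    rewrite /close !ler_norml => /andP[? ?] /andP[? ?].
    by apply/andP; split; lra.
(* [hist k] lists the [k] differences chosen so far, and [d k] is the next. *)
have [next nextP] := choice step.
pose fix hist k := if k is k'.+1 then next (hist k') :: hist k' else [::].
pose d k := next (hist k).
have size_hist k : size (hist k) = k by elim: k => //= k ->.
have mem_hist j k : (j < k)%N -> d j \in hist k.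
  elim: k => // k IHk; rewrite ltnS leq_eqVlt => /predU1P[->|/IHk jk] /=.
    by rewrite mem_head.
  by rewrite in_cons jk orbT.
have d0 : d k @[k --> \oo] --> 0.
  apply: legendre_cvg0; last first.
    by move=> k; have [_ _ + _] := nextP (hist k); rewrite size_hist.
  apply: (@weak_cvg0_of_self _ (C + C)).
    by move=> k; have [] := nextP (hist k).
  move=> j; apply/cvgr0Pnorm_lt => r r0; near=> k.
  have [_ _ _ /(_ (d j))] := nextP (hist k); rewrite size_hist => dj.
  rewrite (le_lt_trans (dj _))//.
    by apply: mem_hist; near: k; exact: nbhs_infty_gt.
  by near: k; exact: (near_infty_natSinv_lt (PosNum r0)).
have [k /=] : exists k, `|d k| < e.
  by apply: (@filter_ex _ \oo); move/cvgr0Pnorm_lt : d0; apply.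
by have [_ + _ _] := nextP (hist k); rewrite ltNge => ->.
Unshelve. all: by end_near. Qed.

(** * Quadratic minimization over a polyhedron *)

Section Minimization.
Context (c : H) (m : nat) (ci : 'I_m -> H) (alpha : 'I_m -> R).
Hypothesis T_cont : continuous T.
Hypothesis T_sa : self_adjoint dot T.
Local Notation f := (qp_objective dot T c).
Local Notation F := (qp_feasible dot ci alpha).

Lemma objectiveD x v : f (x + v) = f x + dot (T x + c) v + 2^-1 * Q v.
Proof.
rewrite /qp_objective /quad_form linearD !(dotDl, dotDr).
by rewrite -(T_sa v x) (dotC (T v)) (T_sa x v); field.
Qed.

Lemma objective_midpoint x y :
  Q (y - x) = 4 * (f x + f y - 2 * f (x + 2^-1 *: (y - x))).
Proof.
have -> : f y = f (x + (y - x)) by rewrite addrC subrK.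
by rewrite !objectiveD quadZ dotZr; field.
Qed.

Lemma objective_cvg (I : Type) (G : set_system I) (GG : Filter G)
    (u : I -> H) x :
  u i @[i --> G] --> x -> f (u i) @[i --> G] --> f x.
Proof.
move=> ux; apply: cvgD; last by apply: dot_cvg => //; exact: cvg_cst.
apply: cvgMr; apply: dot_cvg => //.
exact: (cvg_comp _ _ ux (T_cont x)).
Qed.

Lemma feasible_segment x y (t : R) :
  F x -> F y -> 0 <= t <= 1 -> F (x + t *: (y - x)).
Proof.
move=> Fx Fy /andP[t0 t1] i; have := Fx i; have := Fy i.
by rewrite dotDr dotZr dotBr => hx hy; nra.
Qed.

Lemma feasible_cvg (I : Type) (G : set_system I) (GG : ProperFilter G)
    (u : I -> H) x :
  (forall i, F (u i)) -> u i @[i --> G] --> x -> F x.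
Proof.
move=> Fu ux j.
apply: (@cvgr_to_le _ G _ _ (fun i => dot (ci j) (u i) + alpha j)).
  by apply: cvgD; [apply: dot_cvg => //|]; exact: cvg_cst.
by apply: nearW => i; exact: Fu.
Qed.

(** The midpoint of [x i] and [x j] is feasible, so [f] is at least [mu] there,
    whereas [f (x i)] and [f (x j)] are close to [mu]: the midpoint identity
    makes [Q (x i - x j)] small, and the compactness principle applies. *)
Lemma bounded_minimizing (I : Type) (U : set_system I) (x : I -> H) (C mu : R) :
  UltraFilter U -> (forall i, F (x i)) -> (\forall i \near U, `|x i| <= C) ->
  (forall y, F y -> mu <= f y) ->
  (forall e : R, 0 < e -> \forall i \near U, f (x i) <= mu + e) ->
  exists2 xbar, F xbar & forall y, F y -> f xbar <= f y.
Proof.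
move=> UU Fx xC muF xmu.
have /cvg_ex[xbar xxbar] : cvg (x @ U).
  apply: (legendre_ultra_cvg _ _ _ _ UU xC) => e e0.
  have e8 : 0 < e / 8 by rewrite divr_gt0.
  exists [set i | f (x i) <= mu + e / 8]; first exact: xmu.
  move=> i j /= fi fj; rewrite (objective_midpoint (x j) (x i)).
  have /muF : F (x j + 2^-1 *: (x i - x j)).
    by apply: feasible_segment => //; lra.
  by lra.
exists xbar; first exact: (feasible_cvg _ _ _ _ _ Fx xxbar).
move=> y Fy; apply: le_trans (muF _ Fy).
apply/ler_addgt0Pr => e e0.
exact: (cvgr_to_le (objective_cvg _ _ _ _ _ xxbar) (xmu e e0)).
Qed.

(** Put [u i = (x i - x0) / |x i - x0|].  Expanding [f (x i) <= f x0 + 1]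
    around [x0] shows that [Q (u i)] is at most of order [1 / |x i - x0|].  For a
    fixed [s], the points [x0 + s * u i] lie in [F] as soon as
    [s <= |x i - x0|]; the lower bound on [f] at their midpoints, divided by
    [s^2], shows that [Q (u i - u j)] is at most [2 Q (u i) + 2 Q (u j)] plus a
    term of order [1 / s].  Hence the compactness principle applies to [u]. *)
Lemma unbounded_direction (I : Type) (U : set_system I) (x : I -> H) x0
    (L : R) :
  UltraFilter U -> F x0 -> (forall i, F (x i)) ->
  (forall y, F y -> L <= f y) -> (forall i, f (x i) <= f x0 + 1) ->
  `|x i - x0| @[i --> U] --> +oo ->
  exists v, [/\ `|v| = 1, Q v <= 0, forall j, dot (ci j) v <= 0 &
    `|x i - x0|^-1 *: (x i - x0) @[i --> U] --> v].
Proof.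
move=> UU Fx0 Fx LF fx roo.
set r := fun i => `|x i - x0| in roo *.
set u := fun i => (r i)^-1 *: (x i - x0).
have rge A : \forall i \near U, A <= r i by move: A; apply/cvgryPge.
have r0 : \forall i \near U, 0 < r i.
  by apply: filterS (rge 1) => i; exact: lt_le_trans.
have ru i : 0 < r i -> x i = x0 + r i *: u i.
  by move=> ri; rewrite scalerA divff ?gt_eqF// scale1r addrC subrK.
have u1 i : 0 < r i -> `|u i| = 1.
  by move=> ri; rewrite normrZ normfV normr_id mulVf ?gt_eqF.
have rV : (r i)^-1 @[i --> U] --> 0 by apply/gtr0_cvgV0.
set b := `|T x0 + c|.
have gu i : 0 < r i -> - b <= dot (T x0 + c) (u i) <= b.
  move=> ri; rewrite -ler_norml (le_trans (cauchy_schwarz _ _))//.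
  by rewrite u1// mulr1.
have Qu i : 1 <= r i -> Q (u i) <= (2 + 2 * b) * (r i)^-1.
  move=> ri; have ri0 : 0 < r i by exact: lt_le_trans ri.
  have := fx i; rewrite {1}(ru i ri0) objectiveD quadZ dotZr.
  have /andP[gui _] := gu i ri0.
  rewrite ler_pdivlMr// => h.
  by rewrite -(ler_pM2l ri0); nra.
have Que (e : R) : 0 < e -> \forall i \near U, Q (u i) <= e.
  move=> e0; near=> i; apply: le_trans (Qu i _) _; first by near: i.
  near: i; apply: cvgr_le e0.
  by rewrite -[0](mulr0 (2 + 2 * b)); apply: cvgMr.
have /cvg_ex[v uv] : cvg (u @ U).
  apply: (legendre_ultra_cvg _ _ _ 1 UU) => [|e e0].
    by apply: filterS r0 => i /u1 ->.
  (* With [Q (u i), Q (u j) <= e / 8], the midpoint identity gives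
     [s^2 Q (u i - u j) <= 8 D + 8 s b + s^2 e / 2]; the choice of [s] makes the
     first two terms together at most [s^2 e / 2]. *)
  pose D := f x0 - L; have D0 : 0 <= D by rewrite subr_ge0; exact: LF.
  have b0 : 0 <= b by exact: normr_ge0.
  pose s := 16 * (D + b) / e + 1.
  have s1 : 1 <= s by rewrite lerDr divr_ge0 ?(ltW e0)//; lra.
  have se : 16 * (D + b) <= s * e.
    have -> : s * e = 16 * (D + b) + e by rewrite /s; field; rewrite gt_eqF.
    by rewrite lerDl ltW.
  exists [set i | s <= r i /\ Q (u i) <= e / 8].
    by near=> i; split; near: i => //; apply: Que; rewrite divr_gt0.
  have Fp i : s <= r i -> F (x0 + s *: u i).
    move=> sri; rewrite /u scalerA; apply: feasible_segment => //.
    have ri0 : 0 < r i by exact: lt_le_trans (lt_le_trans ltr01 s1) sri.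
    by rewrite divr_ge0 ?ler_pdivrMr ?mul1r ?(ltW ri0)//; lra.
  have fp i : 0 < r i ->
      f (x0 + s *: u i) <= f x0 + s * b + 2^-1 * (s ^+ 2 * Q (u i)).
    move=> ri0; rewrite objectiveD quadZ dotZr.
    by have /andP[_] := gu i ri0; nra.
  move=> i j /= [ri Qi] [rj Qj].
  have ri0 : 0 < r i by exact: lt_le_trans (lt_le_trans ltr01 s1) ri.
  have rj0 : 0 < r j by exact: lt_le_trans (lt_le_trans ltr01 s1) rj.
  have := objective_midpoint (x0 + s *: u j) (x0 + s *: u i).
  have {1}-> : x0 + s *: u i - (x0 + s *: u j) = s *: (u i - u j).
    by rewrite opprD addrACA subrr add0r scalerBr.
  rewrite quadZ => QE.
  have /LF Lm : F (x0 + s *: u j + 2^-1 *: (x0 + s *: u i - (x0 + s *: u j))).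
    by apply: feasible_segment; [exact: Fp|exact: Fp|lra].
  have s20 : 0 < s ^+ 2 by rewrite exprn_gt0//; lra.
  rewrite -(ler_pM2l s20) QE.
  have s0 : 0 <= s by exact: le_trans s1.
  have := ler_wpM2l s0 se; have := ler_wpM2r D0 s1.
  have := ler_wpM2l (ltW s20) Qi; have := ler_wpM2l (ltW s20) Qj.
  by have := fp i ri0; have := fp j rj0; rewrite /D; lra.
exists v; split=> //.
- have h : `|u i| @[i --> U] --> `|v| by apply: cvg_norm.
  have h1 : `|u i| @[i --> U] --> (1 : R).
    by apply: cvg_near_cst; apply: filterS r0 => i /u1 ->.
  exact: (cvg_unique _ h h1).
- apply/ler_addgt0Pr => e e0; rewrite add0r.
  apply: (@cvgr_to_le _ U _ _ (fun i => Q (u i))); last exact: Que.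
  by apply: dot_cvg => //; exact: (cvg_comp _ _ uv (T_cont v)).
- move=> j.
  pose beta := dot (ci j) x0 + alpha j.
  apply: (@cvgr_to_le _ U _ _ (fun i => dot (ci j) (u i) + beta * (r i)^-1)).
    rewrite -[dot _ v]addr0 -(mulr0 beta); apply: cvgD; last exact: cvgMr.
    by apply: dot_cvg => //; exact: cvg_cst.
  near=> i; have ri0 : 0 < r i by near: i.
  rewrite -(ler_pM2l ri0) mulr0 mulrDr mulrCA divff ?gt_eqF// mulr1 -dotZr.
  have := Fx i j.
  by rewrite {1}(ru i ri0) dotDr /beta; lra.
Unshelve. all: by end_near. Qed.

(** Along the half-line [y + t * v], which stays in [F], the quadratic term of
    [f] is nonpositive; a negative slope would send [f] to minus infinity. *)
Lemma gradient_recession_ge0 (L : R) v y :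
  (forall z, F z -> L <= f z) -> (forall j, dot (ci j) v <= 0) -> Q v <= 0 ->
  F y -> 0 <= dot (T y + c) v.
Proof.
move=> LF civ Qv Fy; rewrite leNgt; apply/negP => a0.
set a := dot _ v in a0.
(* At this [t] the linear part of [f] takes the value [L - 1]. *)
pose t := (f y - L + 1) / - a.
have t0 : 0 <= t.
  by rewrite divr_ge0 ?oppr_ge0 ?(ltW a0)//; have := LF y Fy; lra.
have /LF : F (y + t *: v).
  by move=> j; rewrite dotDr dotZr; have := Fy j; have := civ j; nra.
rewrite objectiveD quadZ dotZr -/a.
have -> : t * a = - (f y - L + 1).
  by rewrite /t invrN mulrN mulNr divfK// lt_eqF.
by have := mulr_ge0_le0 (sqr_ge0 t) Qv; lra.
Qed.

Lemma qp_attained : F !=set0 -> has_lbound (f @` F) ->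
  exists2 xbar, F xbar & forall y, F y -> f xbar <= f y.
Proof.
move=> [x0 Fx0] [L LfF].
have LF y : F y -> L <= f y by move=> Fy; apply: LfF; exists y.
have [U [UU ooU]] := ultraFilterLemma (F := \oo) _.
pose g k y := f y + k.+1%:R^-1 * `|y - x0| ^+ 2.
have eps0 k : 0 < k.+1%:R^-1 :> R by rewrite invr_gt0.
have /choice[x xP] : forall k, exists x,
    F x /\ forall y, F y -> g k x < g k y + k.+1%:R^-1.
  move=> k; have hasinf : has_inf (g k @` F).
    split; first by exists (g k x0), x0.
    exists L => _ [y Fy <-]; rewrite (le_trans (LF y Fy))// lerDl.
    by rewrite mulr_ge0// ltW.
  have [_ [y Fy <-] ylt] := inf_adherent (eps0 k) hasinf.
  exists y; split=> // z Fz; rewrite (lt_le_trans ylt)// lerD2r.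
  by apply: ge_inf; [exact: hasinf.2|exists z].
have Fx k := (xP k).1.
have fx y k : F y -> f (x k) <= f y + k.+1%:R^-1 * (`|y - x0| ^+ 2 + 1).
  move=> Fy; have := (xP k).2 y Fy; rewrite /g.
  by have := eps0 k; have := sqr_ge0 `|x k - x0|; set e := _^-1; nra.
have [[C xC]|nbnd] := pselect (exists C, \forall k \near U, `|x k| <= C).
  have hasinf : has_inf (f @` F).
    by split; [exists (f x0), x0|exists L].
  apply: (bounded_minimizing _ _ _ _ (inf (f @` F)) UU Fx xC).
    by move=> y Fy; apply: ge_inf; [exists L|exists y].
  move=> e e0; have e2 : 0 < e / 2 by rewrite divr_gt0.
  have [_ [y Fy <-] ylt] := inf_adherent e2 hasinf.
  near=> k; have := fx y k Fy.
  have : k.+1%:R^-1 * (`|y - x0| ^+ 2 + 1) <= e / 2.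
    rewrite -ler_pdivlMr ?ltr_wpDl//; apply: ltW; near: k; apply: ooU.
    have q0 : 0 < e / 2 / (`|y - x0| ^+ 2 + 1).
      by rewrite divr_gt0// ltr_wpDl.
    exact: (near_infty_natSinv_lt (PosNum q0)).
  by set w := _ * _; lra.
exfalso.
have roo : `|x k - x0| @[k --> U] --> +oo.
  apply/cvgryPge => A.
  have [//|UnA] := in_ultra_setVsetC [set k | A <= `|x k - x0|] UU.
  exfalso; apply: nbnd; exists (A + `|x0|).
  apply: filterS UnA => k /= /negP; rewrite -ltNge => kA.
  by rewrite -[x k](subrK x0) (le_trans (ler_normD _ _))// lerD2r ltW.
have rge A : \forall k \near U, A <= `|x k - x0| by move: A; apply/cvgryPge.
have fx0 k : f (x k) <= f x0 + 1.
  apply: le_trans (fx x0 k Fx0) _.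
  by rewrite subrr normr0 expr0n add0r mulr1 lerD2l invf_le1// ler1n.
have [v [v1 Qv civ uv]] := unbounded_direction _ _ _ _ _ UU Fx0 Fx LF fx0 roo.
have gv y Fy := @gradient_recession_ge0 _ v y LF civ Qv Fy.
set u := fun k => `|x k - x0|^-1 *: (x k - x0) in uv.
have uvv : dot (u k) v @[k --> U] --> (1 : R).
  have -> : 1 = dot v v by rewrite dotxx v1 expr1n.
  by apply: dot_cvg => //; exact: cvg_cst.
(* Once [|x k - x0| >= 2] and [<u k, v> >= 1/2], moving from [x k] to [x k - v]
   changes [|x k - x0|^2] by [1 - 2 <x k - x0, v>], which is at most [-1]. *)
have [k [k2 kv kF]] : exists k, [/\ 2 <= `|x k - x0|,
    2^-1 <= dot (u k) v & F (x k - v)].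
  apply: (@filter_ex _ U); near=> k; split; near: k => //.
    by apply: cvgr_ge uvv _ _; lra.
  apply: filter_forall => j.
  (* If [<c_i, v> < 0], then [<c_i, u k>] is eventually at most half of it, so
     [<c_i, x k - x0>] is at most [<c_i, v>] once [|x k - x0| >= 2]. *)
  have := civ j; rewrite le_eqVlt => /predU1P[cv0|cv0].
    by apply: nearW => k; have := Fx k j; rewrite dotBr cv0 subr0.
  have ucvg : dot (ci j) (u k) @[k --> U] --> dot (ci j) v.
    by apply: dot_cvg; [exact: cvg_cst|exact: uv].
  have unear : \forall k \near U, dot (ci j) (u k) <= dot (ci j) v / 2.
    by apply: (cvgr_le _ ucvg); lra.
  near=> k; have r2 : 2 <= `|x k - x0| by near: k.
  have r0 : 0 < `|x k - x0| by lra.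
  have cu : dot (ci j) (u k) <= dot (ci j) v / 2 by near: k.
  by have := Fx0 j; move: cu; rewrite /u dotZr !dotBr mulrC ler_pdivrMr//; nra.
have r0 : 0 < `|x k - x0| by lra.
have := (xP k).2 _ kF; rewrite /g.
have -> : x k - v - x0 = x k - x0 - v by rewrite addrAC.
rewrite [`|x k - x0 - v| ^+ 2]normBsq v1 expr1n.
have -> : f (x k) = f (x k - v) + dot (T (x k) + c) v - 2^-1 * Q v.
  by rewrite -[- v]scaleN1r objectiveD quadZ dotZr sqrrN expr1n; ring.
move: kv; rewrite /u dotZl mulrC ler_pdivlMr// => kv.
by have := gv _ (Fx k); have := eps0 k; set e := _^-1; nra.
Unshelve. all: by end_near. Qed.

End Minimization.

End Legendre.

End InnerProduct.

Theorem corollary3p1 (R : realType) (H : completeNormedModType R)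
    (dot : {dot H for idfun}) (m : nat) (T : {linear H -> H}) (c : H)
    (ci : 'I_m -> H) (alpha : 'I_m -> R)
    (H_hilbert : hilbert_dot dot)
    (m_gt0 : (0 < m)%N)
    (T_cont : continuous T)
    (T_sa : self_adjoint dot T)
    (T_legendre : legendre_form dot (quad_form dot T))
    (F_neq0 : qp_feasible dot ci alpha !=set0)
    (f_bounded : has_lbound (qp_objective dot T c @` qp_feasible dot ci alpha)) :
  exists2 xbar : H, qp_feasible dot ci alpha xbar &
    forall x : H, qp_feasible dot ci alpha x ->
      qp_objective dot T c xbar <= qp_objective dot T c x.
Proof. exact: qp_attained. Qed.
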